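(* Let $\mathcal{G}=(\mathcal{V},\mathcal{E})$ be a rooted temporal tree with $n=|\mathcal{V}|$ nodes and root $r$ in which every edge is associated with exactly one time interval. Then Algorithm A (described in the context) runs on $\mathcal{G}$ in $O(n^3)$ time.
   Context: A temporal graph $\mathcal{G}=(\mathcal{V},\mathcal{E})$ with lifetime $\mathcal{T}$ has a finite node set $\mathcal{V}$ and a finite edge set $\mathcal{E}$; each edge joins two distinct nodes (at most one edge per pair) and is associated with a nonempty list of time intervals $[s_1,f_1),\dots,[s_k,f_k)$, integers $0\le s_1<f_1<s_2<\dots<s_k<f_k\le\mathcal{T}$; it exists at each integer timestep in one of these intervals. A rooted temporal tree is a temporal graph whose underlying static graph (an edge $\{u,v\}$ per temporal edge) is a tree, with a designated root $r$; $P(v)$ is the parent of $v\ne r$, $child(v)$ its children, depth is distance from $r$. Two distinct edges overlap if they share an endpoint and exist at a common timestep. For a set $S$ of edges all incident on a common node, $MaxNOS(S)$ denotes a maximum-cardinality subset of $S$ with no two edges overlapping, computed (as a maximum set of pairwise disjoint intervals) in $O(|S|\log|S|)$ time. Algorithm A: If $r$ has no children, output $\emptyset$. Otherwise process the nodes in non-increasing order of depth. For a leaf $u$, set $M_u:=\emptyset$. For a non-leaf $v$ with children $u_1,\dots,u_k$: (i) $TM1[v]:=M_{u_1}\cup\dots\cup M_{u_k}$; (ii) let $\tilde{\mathcal{R}}_0(v)$ be the set of edges $e_{vu_i}$ such that no edge of $M_{u_i}$ overlaps $e_{vu_i}$; if $\tilde{\mathcal{R}}_0(v)=\emptyset$ set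 $F_v:=\emptyset$; else if $v=r$ set $F_v:=MaxNOS(\tilde{\mathcal{R}}_0(v))$; else with $\tilde{\mathcal{R}}^P_0(v):=\tilde{\mathcal{R}}_0(v)\cup\{e_{vP(v)}\}$ set $F_v:=MaxNOS(\tilde{\mathcal{R}}^P_0(v))\setminus\{e_{vP(v)}\}$ if $|MaxNOS(\tilde{\mathcal{R}}^P_0(v))|>|MaxNOS(\tilde{\mathcal{R}}_0(v))|$, and $F_v:=MaxNOS(\tilde{\mathcal{R}}_0(v))$ otherwise; (iii) $TM2[v]:=\emptyset$ if $F_v=\emptyset$, else $TM1[v]\cup F_v$; (iv) $M_v:=$ the larger (in cardinality) of $TM1[v],TM2[v]$. Output $M_r$. *)

(* Defs.v *)
From HB Require Import structures.
From mathcomp Require Import all_boot.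

Set Implicit Arguments.
Unset Strict Implicit.
Unset Printing Implicit Defensive.

(** * Temporal graphs and trees *)

(* The list [:: (s_1, f_1); ...; (s_k, f_k)] stands for [s_1,f_1), ..., [s_k,f_k)
   and is valid when 0 <= s_1 < f_1 < s_2 < ... < s_k < f_k <= T. *)
Definition valid_intervals (T : nat) (l : seq (nat * nat)) : bool :=
  let bounds := flatten [seq [:: i.1; i.2] | i <- l] in
  sorted ltn bounds && all (fun t => t <= T) bounds.

(* The orientation src/dst of an edge is only a way of storing the unordered
   pair of its endpoints. *)
Record temporalGraph := TemporalGraph {
  node : finType;
  edge : finType;
  lifetime : nat;
  src : edge -> node;
  dst : edge -> node;
  intervals : edge -> seq (nat * nat);
  src_neq_dst : forall e, src e != dst e;
  edge_simple : forall e e',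
    [set src e; dst e] = [set src e'; dst e'] -> e = e';
  intervals_neq0 : forall e, intervals e != [::];
  intervals_valid : forall e, valid_intervals lifetime (intervals e)
}.

Section TemporalGraphs.
Variable G : temporalGraph.
Implicit Types (e : edge G) (u v : node G) (S X Y : seq (edge G)).

Definition incident v e : bool := (v == src e) || (v == dst e).

Definition exists_at e (t : nat) : bool :=
  has (fun i => i.1 <= t < i.2) (intervals e).

Definition overlap e e' : Prop :=
  [/\ e <> e',
      exists v, incident v e /\ incident v e'
    & exists t, exists_at e t /\ exists_at e' t].

(* Adjacency in the underlying static graph. *)
Definition adj : rel (node G) :=
  [rel u v | [exists e, [set src e; dst e] == [set u; v]]].

(* Connected and without simple cycle of length at least 3; as adj is
   symmetric, [:: u; v] is a ucycle as soon as u and v are adjacent. *)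
Definition is_tree : Prop :=
  (forall u v, connect adj u v) /\
  (forall c : seq (node G), ucycle adj c -> size c <= 2).

Definition single_interval : Prop := forall e, size (intervals e) = 1.

Definition nonoverlapping X : Prop :=
  forall e e', e \in X -> e' \in X -> ~ overlap e e'.

(* Finite sets of edges are represented by duplicate-free lists. *)
Definition is_MaxNOS S X : Prop :=
  [/\ uniq X, {subset X <= S}, nonoverlapping X
    & forall Y, uniq Y -> {subset Y <= S} -> nonoverlapping Y ->
        size Y <= size X].

Definition star S : Prop :=
  uniq S /\ exists v, forall e, e \in S -> incident v e.

End TemporalGraphs.

(** * Cost model *)

(* Unit-cost random access machine. A computation is a value together with the
   number of instructions spent on it. op x charges one instruction and is only
   applied to an x that takes constant time: comparison of two nodes, edges or
   integers, incrementation, reading a field of an edge, reading or writing one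
   array cell, building or inspecting one list cell. Every iteration is charged
   through forC, loopC or newC, so the code left uncharged (let, if, tuples,
   Boolean connectives) has constant length between two charges. *)
Definition cost (A : Type) : Type := (A * nat)%type.
Definition result A (m : cost A) : A := m.1.
Definition time A (m : cost A) : nat := m.2.

Definition ret A (x : A) : cost A := (x, 0).
Definition bind A B (m : cost A) (f : A -> cost B) : cost B :=
  let r := f (result m) in (result r, time m + time r).
Definition op A (x : A) : cost A := (x, 1).

Notation "'do' x <- m ; k" := (bind m (fun x => k))
  (at level 200, x name, m at level 100, k at level 200,
   format "'[v' 'do'  x  <-  m ; '/' k ']'").

Fixpoint forC A B (s : seq A) (acc : B) (body : A -> B -> cost B) : cost B :=
  if s is x :: s' then
    do _ <- op tt;
    do acc' <- body x acc;
    forC s' acc' body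
  else op acc.

(* while-loop: body returns the new state, and false in order to stop. The fuel
   is only there to make the recursion structural. *)
Fixpoint loopC A (fuel : nat) (st : A) (body : A -> cost (bool * A)) : cost A :=
  if fuel is fuel'.+1 then
    do _ <- op tt;
    do bst <- body st;
    if bst.1 then loopC fuel' bst.2 body else ret bst.2
  else ret st.

(* Arrays indexed by a finite type; newC initializes all the cells. *)
Definition newC (I : finType) A (x : A) : cost (I -> A) := ((fun=> x), #|I|.+1).
Definition getC (I : finType) A (a : I -> A) (i : I) : cost A := op (a i).
Definition setC (I : finType) A (a : I -> A) (i : I) (x : A) : cost (I -> A) :=
  op (fun j => if j == i then x else a j).

Definition is_nilC A (s : seq A) : cost bool := op (nilp s).
Definition lengthC A (s : seq A) : cost nat := forC s 0 (fun _ k => op k.+1).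
Definition has_C A (test : A -> cost bool) (s : seq A) : cost bool :=
  forC s false (fun x b => do c <- test x; ret (b || c)).
Definition memC (E : eqType) (x : E) (s : seq E) : cost bool :=
  has_C (fun y => op (x == y)) s.
Definition unionC (E : eqType) (s1 s2 : seq E) : cost (seq E) :=
  forC s1 s2 (fun x acc =>
    do b <- memC x acc;
    if b then ret acc else op (x :: acc)).
Definition removeC (E : eqType) (x : E) (s : seq E) : cost (seq E) :=
  forC s [::] (fun y acc =>
    do b <- op (x == y);
    if b then ret acc else op (y :: acc)).
Definition prependC A (s1 s2 : seq A) : cost (seq A) :=
  forC s1 s2 (fun x acc => op (x :: acc)).

(** * Algorithm A *)

Section Algorithm.
Variable G : temporalGraph.
Variable MaxNOS : seq (edge G) -> cost (seq (edge G)).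
Variable r : node G.
Implicit Types (e : edge G) (u v : node G).

Definition share_endpointC e e' : cost bool :=
  do a <- op (src e); do b <- op (dst e);
  do a' <- op (src e'); do b' <- op (dst e');
  do c1 <- op (a == a'); do c2 <- op (a == b');
  do c3 <- op (b == a'); do c4 <- op (b == b');
  ret [|| c1, c2, c3 | c4].

Definition overlapC e e' : cost bool :=
  do same <- op (e == e');
  do touch <- share_endpointC e e';
  do l <- op (intervals e);
  do l' <- op (intervals e');
  do meet <- has_C (fun i => has_C (fun j =>
               do c1 <- op (i.1 < j.2);
               do c2 <- op (j.1 < i.2);
               ret (c1 && c2)) l') l;
  ret [&& ~~ same, touch & meet].

(* The endpoint of e other than v, if v is an endpoint of e. *)
Definition otherC v e : cost (option (node G)) :=
  do a <- op (src e); do b <- op (dst e);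
  do c1 <- op (v == a); do c2 <- op (v == b);
  ret (if c1 then Some b else if c2 then Some a else None).

(** Rooting: the input is the list of the edges and the root. A breadth-first
    search computes the parents, the children and the depth levels. *)

Record bfsState := BfsState {
  marked : node G -> bool;
  (* the edge joining a node to its parent *)
  parent : node G -> option (edge G);
  (* the children of a node, each with the edge leading to it *)
  children : node G -> seq (node G * edge G)
}.

Definition exploreC v (st : bfsState * seq (node G))
    : cost (bfsState * seq (node G)) :=
  forC (enum (edge G)) st (fun e st =>
    do w <- otherC v e;
    if w is Some u then
      do seen <- getC (marked st.1) u;
      if seen then ret st else
      do mk <- setC (marked st.1) u true;
      do pa <- setC (parent st.1) u (Some e);
      do ks <- getC (children st.1) v;
      do ks' <- op ((u, e) :: ks);
      do ch <- setC (children st.1) v ks';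
      do next <- op (u :: st.2);
      ret (BfsState mk pa ch, next)
    else ret st).

(* State of the loop: the search state, the list of the nodes of the current
   depth, and the list of all the nodes of smaller depth, deepest first. A tree
   has at most #|node G| nonempty levels, so the loop stops by itself. The
   resulting list has all the nodes, in non-increasing order of depth. *)
Definition bfsC : cost (bfsState * seq (node G)) :=
  do mk0 <- newC (node G) false;
  do mk <- setC mk0 r true;
  do pa <- newC (node G) None;
  do ch <- newC (node G) [::];
  do level0 <- op [:: r];
  do out <- loopC #|node G|.+1 (BfsState mk pa ch, level0, [::]) (fun st =>
    do stop <- is_nilC st.1.2;
    if stop then ret (false, st) else
    do order <- prependC st.1.2 st.2;
    do st' <- forC st.1.2 (st.1.1, [::]) exploreC;
    ret (true, (st', order)));
  ret (out.1.1, out.2).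

(** Processing of a node v whose children have been processed; M is the array
    of the sets M_u and T the result of the search. *)

Definition TM1C (M : node G -> seq (edge G)) (kids : seq (node G * edge G))
    : cost (seq (edge G)) :=
  forC kids [::] (fun ue acc =>
    do Mu <- getC M ue.1;
    unionC Mu acc).

Definition R0C (M : node G -> seq (edge G)) (kids : seq (node G * edge G))
    : cost (seq (edge G)) :=
  forC kids [::] (fun ue acc =>
    do Mu <- getC M ue.1;
    do bad <- has_C (fun e => overlapC e ue.2) Mu;
    if bad then ret acc else op (ue.2 :: acc)).

(* The edge to the parent is None only for the root, so the last case does not
   occur. *)
Definition FC (T : bfsState) v (R0 : seq (edge G)) : cost (seq (edge G)) :=
  do empty <- is_nilC R0;
  if empty then ret [::] else
  do isroot <- op (v == r);
  if isroot then MaxNOS R0 else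
  do pe <- getC (parent T) v;
  if pe is Some e then
    do R0P <- op (e :: R0);
    do XP <- MaxNOS R0P;
    do X <- MaxNOS R0;
    do kP <- lengthC XP;
    do k <- lengthC X;
    do gt <- op (k < kP);
    if gt then removeC e XP else ret X
  else ret [::].

Definition nodeC (T : bfsState) v (M : node G -> seq (edge G))
    : cost (node G -> seq (edge G)) :=
  do kids <- getC (children T) v;
  do leaf <- is_nilC kids;
  if leaf then setC M v [::] else
  do TM1 <- TM1C M kids;
  do R0 <- R0C M kids;
  do F <- FC T v R0;
  do emptyF <- is_nilC F;
  do TM2 <- (if emptyF then ret [::] else unionC F TM1);
  do k1 <- lengthC TM1;
  do k2 <- lengthC TM2;
  do gt <- op (k1 < k2);
  setC M v (if gt then TM2 else TM1).

Definition algorithmA : cost (seq (edge G)) :=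
  do T <- bfsC;
  do kids <- getC (children T.1) r;
  do leaf <- is_nilC kids;
  if leaf then ret [::] else
  do M0 <- newC (node G) [::];
  do M <- forC T.2 M0 (nodeC T.1);
  getC M r.

End Algorithm.

(* Main.v *)
(** Rooting the graph by breadth-first search expands every node once, and each
    expansion scans the edge list, which has at most [n^2] entries because the
    graph is simple. The edges that occur in the sets [M_u] are all edges from a
    node to its parent, so these sets have at most [n] elements. Hence a node with
    [k] children is processed in time [O((k + 1) n^2)], where the two calls to
    MaxNOS on at most [k + 1] edges are covered by [s log s <= s^2]. As every node
    is the child of at most one node, summing over all nodes gives [O(n^3)]. *)
Require Import Defs.
From HB Require Import structures.
From mathcomp Require Import all_boot.
From mathcomp Require Import zify.

Set Implicit Arguments.
Unset Strict Implicit.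
Unset Printing Implicit Defensive.

(** * A program logic for costs *)

(** A Hoare triple with a time bound. Postcondition and bound travel together because the time of
    later code depends on the sizes of the values computed earlier. *)
Definition runs A (m : cost A) (Q : A -> Prop) (t : nat) : Prop :=
  Q (result m) /\ time m <= t.

Section Runs.
Variables A B : Type.
Implicit Types (m : cost A) (f : A -> cost B).

Lemma runs_le m (Q : A -> Prop) t t' : runs m Q t -> t <= t' -> runs m Q t'.
Proof. by move=> [Qm lt_m] le_t; split=> //; apply: leq_trans le_t. Qed.

Lemma runs_ret (Q : A -> Prop) (x : A) t : Q x -> runs (ret x) Q t.
Proof. by []. Qed.

Lemma runs_op1 (Q : A -> Prop) (x : A) t : Q x -> runs (op x) Q t.+1.
Proof. by []. Qed.

Lemma runs_op (Q : B -> Prop) (x : A) f t :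
  runs (f x) Q t -> runs (bind (op x) f) Q t.+1.
Proof. by []. Qed.

Lemma runs_bind m f (P : A -> Prop) (Q : B -> Prop) t1 t2 :
  runs m P t1 -> (forall x, P x -> runs (f x) Q t2) ->
  runs (bind m f) Q (t1 + t2).
Proof.
by move=> [Pm le1] /(_ _ Pm)[Qf le2]; split=> //; apply: leq_add.
Qed.

End Runs.

(** * Rules for loops *)

Section Loops.
Variables (A : eqType) (B : Type).

(** The weight [w] may vary with the element: this is what later allows summing over the nodes, each
    weighted by its number of children. The outer successor pays for the final [op acc]. *)
Lemma runs_forC (P : B -> Prop) (w : A -> nat) (s : seq A) (acc : B)
    (body : A -> B -> cost B) :
  P acc ->
  (forall x b, x \in s -> P b -> runs (body x b) P (w x)) ->
  runs (forC s acc body) P (\sum_(x <- s) (w x).+1).+1.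
Proof.
elim: s acc => [|x s IHs] acc Pacc Pbody /=; first exact: runs_op1.
rewrite big_cons.
apply: (@runs_le _ _ _ (w x + (\sum_(y <- s) (w y).+1).+1).+1); last by lia.
apply: runs_op; apply: runs_bind (Pbody x acc _ Pacc) _; first exact: mem_head.
move=> b Pb; apply: IHs => // y c ys; apply: Pbody.
by rewrite inE ys orbT.
Qed.

Lemma runs_forC_const (P : B -> Prop) c (s : seq A) (acc : B)
    (body : A -> B -> cost B) :
  P acc ->
  (forall x b, x \in s -> P b -> runs (body x b) P c) ->
  runs (forC s acc body) P (size s * c.+1).+1.
Proof.
move=> Pacc Pbody; apply: runs_le (runs_forC Pacc Pbody) _.
by rewrite big_const_seq count_predT iter_addn_0 mulnC.
Qed.

(** Consing onto the accumulator reverses the order, hence [catrev]. Only the result of the body is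
    constrained, so its charges play no part in the computation of the list. *)
Lemma result_forC_filter (b : pred A) (g : A -> B) (s : seq A) (acc : seq B)
    (body : A -> seq B -> cost (seq B)) :
  (forall x t, result (body x t) = if b x then t else g x :: t) ->
  result (forC s acc body) = catrev [seq g x | x <- s & ~~ b x] acc.
Proof.
move=> def_body; elim: s acc => [//|x s IHs] acc.
rewrite /= -[LHS]/(result (forC s (result (body x acc)) body)) IHs def_body.
by case: (b x).
Qed.

(** Amortized analysis: a round may cost more than [c] if the potential drops by the excess, so the
    total is [c.+1] per unit of fuel plus the initial potential. *)
Lemma runs_loopC (P : B -> Prop) (pot : B -> nat) c (fuel : nat) (st : B)
    (body : B -> cost (bool * B)) :
  P st ->
  (forall x, P x -> exists t,
     runs (body x) (fun y => P y.2 /\ t + pot y.2 <= c + pot x) t) ->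
  runs (loopC fuel st body) P (fuel * c.+1 + pot st).
Proof.
move=> + Pbody; elim: fuel st => [|fuel IHf] st Pst //=.
have [t t_st] := Pbody st Pst.
(* The truncated subtraction is exact, since the postcondition of the body gives
   [t <= c + pot st]. *)
apply: (@runs_le _ _ _ (t + (fuel * c.+1 + c + pot st - t)).+1); last first.
  by case: t_st => -[_ le_t] _; lia.
apply/runs_op/(runs_bind t_st) => -[[] st' [/= Pst' le_t]]; last exact: runs_ret.
by apply: runs_le (IHf _ Pst') _; lia.
Qed.

End Loops.

Lemma runs_has_C (A : eqType) c (test : A -> cost bool) (s : seq A) :
  (forall x, x \in s -> time (test x) <= c) ->
  runs (has_C test s) (fun=> True) (size s * c.+1).+1.
Proof.
move=> le_test; apply: (@runs_forC_const _ _ (fun=> True)) => // x b xs _.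
by split=> //; rewrite /time /= addn0; apply: le_test.
Qed.

Lemma runs_lengthC (A : eqType) (s : seq A) :
  runs (lengthC s) (fun=> True) (2 * size s).+1.
Proof. by rewrite mulnC; apply: (@runs_forC_const _ _ (fun=> True) 1). Qed.

Lemma result_prependC (A : eqType) (s1 s2 : seq A) :
  result (prependC s1 s2) = catrev s1 s2.
Proof.
by rewrite (result_forC_filter (b := pred0) (g := id)) // map_id filter_predT.
Qed.

Lemma time_prependC (A : eqType) (s1 s2 : seq A) :
  time (prependC s1 s2) <= (2 * size s1).+1.
Proof.
have [//] : runs (prependC s1 s2) (fun=> True) (2 * size s1).+1.
by rewrite mulnC; apply: (@runs_forC_const _ _ (fun=> True) 1).
Qed.

(** * Duplicate-free lists as finite sets *)

Section ListSets.
Variable E : eqType.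
Implicit Types (D s : seq E) (x : E).

Lemma runs_memC x s : runs (memC x s) (eq (x \in s)) (2 * size s).+1.
Proof.
split; last first.
  by rewrite mulnC; case: (@runs_has_C _ 1 (fun y => op (x == y)) s).
rewrite /memC /has_C -[x \in s]/(false || (x \in s)).
elim: s false => [|y s IHs] b /=; first by rewrite orbF.
by rewrite in_cons orbA IHs.
Qed.

Definition uniq_sub D s : Prop := uniq s /\ {subset s <= D}.

Lemma size_uniq_sub D s : uniq_sub D s -> size s <= size D.
Proof. by case=> uniq_s sub_s; apply: uniq_leq_size. Qed.

(** The accumulator remains a duplicate-free list over [D], so each membership test scans at most
    [size D] cells. *)
Lemma runs_unionC D s1 s2 : {subset s1 <= D} -> uniq_sub D s2 ->
  runs (unionC s1 s2) (uniq_sub D) (size s1 * (2 * size D + 3)).+1.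
Proof.
move=> sub1 us2; rewrite addn3; apply: (@runs_forC_const _ _ (uniq_sub D)) => // x s xs us.
apply: (@runs_le _ _ _ ((2 * size s).+1 + 1)).
  apply: runs_bind (runs_memC x s) _ => _ <-; case: ifPn => // xNs.
  apply: runs_op1; have [uniq_s sub_s] := us; split; first by rewrite /= xNs.
  by move=> y; rewrite inE => /predU1P[->|/sub_s//]; apply: sub1.
by have := size_uniq_sub us; lia.
Qed.

Lemma runs_removeC x s :
  runs (removeC x s)
    (fun s' => {subset s' <= s} /\ size s' <= size s) (3 * size s).+1.
Proof.
split; last first.
  have [//] : runs (removeC x s) (fun=> True) (3 * size s).+1.
  rewrite mulnC; apply: (@runs_forC_const _ _ (fun=> True) 2) => // y s' _ _.
  by apply: runs_op; case: ifP.
rewrite (result_forC_filter (b := pred1 x) (g := id)) => [|y t]; last first.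
  by rewrite /= eq_sym; case: eqP.
rewrite map_id catrevE cats0 size_rev size_filter count_size; split=> // y.
by rewrite mem_rev mem_filter => /andP[].
Qed.

End ListSets.

(** * Rooting *)

Section Rooting.
Variable G : temporalGraph.
Implicit Types (e : edge G) (u v w : node G) (st : bfsState G).

Local Notation n := #|node G|.

(** By [edge_simple], the stored ordered pair of endpoints determines the edge. *)
Lemma card_edge_le : #|edge G| <= n ^ 2.
Proof.
rewrite -mulnn -card_prod.
apply: (leq_card (fun e => (src e, dst e))) => e e' [es ed].
by apply: edge_simple; rewrite es ed.
Qed.

(** The invariant of the search. [parent_marked] ensures that an edge with an unmarked endpoint is
    not yet a parent edge. [children_count] is a budget: discovering a node moves one unit from the
    unmarked nodes to the child lists, which therefore never have more than [n] entries in total. *)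
Record rooted st : Prop := Rooted {
  parent_incident : forall u e, parent st u = Some e -> incident u e;
  parent_marked : forall u w e,
    parent st u = Some e -> incident w e -> marked st w;
  parent_inj : forall u w e,
    parent st u = Some e -> parent st w = Some e -> u = w;
  child_parent : forall u v e, (u, e) \in children st v ->
    [/\ parent st u = Some e, incident v e & u != v];
  children_uniq : forall v, uniq (children st v);
  children_count :
    \sum_v size (children st v) + #|[pred u | ~~ marked st u]| <= n
}.

Lemma rooted_init r : rooted (BfsState (fun j => if j == r then true else false)
                                (fun=> None) (fun=> [::])).
Proof.
split=> //=; rewrite big1 // add0n; exact: max_card.
Qed.

(** As [u] is unmarked, [e] is nobody's parent edge ([fresh]) and [u] has no parent edge so far
    ([no_parent]); hence the new entries clash with no old one. *)
Lemma rooted_step st v u e :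
  rooted st -> marked st v -> ~~ marked st u ->
  incident v e -> incident u e -> u != v ->
  (forall w, incident w e -> (w == u) || (w == v)) ->
  rooted (BfsState (fun j => if j == u then true else marked st j)
            (fun j => if j == u then Some e else parent st j)
            (fun j => if j == v then (u, e) :: children st v
                      else children st j)).
Proof.
move=> [pinc pmark pinj cpar cuniq ccount] mv mNu ve ue uv ends.
have fresh w : parent st w <> Some e.
  by move=> pw; rewrite (pmark _ _ _ pw ue) in mNu.
have no_parent w e' : parent st w = Some e' -> w != u.
  by move=> pw; apply: contraNneq mNu => <-; apply: pmark pw (pinc _ _ pw).
split=> /=.
- by move=> w e'; case: eqP => [-> [<-]|_ /pinc].
- move=> w x e'; case: eqP => [_ [<-] /ends|_ pw xe']; last first.
    by rewrite (pmark _ _ _ pw xe') if_same.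
  by case/orP=> /eqP ->; rewrite ?eqxx ?mv ?if_same.
- move=> w x e'; case: eqP => [-> [<-]|_ pw]; case: eqP => [-> //|_ px].
  + by have := fresh x.
  + by case=> ee'; rewrite ee' in fresh; have := fresh w.
  + exact: pinj px.
- move=> w x e'; case: (x =P v) => [->|_].
    rewrite inE => /predU1P[[-> ->]|/cpar[pw xe' wv]]; first by rewrite eqxx.
    by rewrite (negPf (no_parent _ _ pw)).
  by case/cpar=> pw xe' wx; rewrite (negPf (no_parent _ _ pw)).
- move=> w; case: ifP => [_|//] /=; rewrite cuniq andbT.
  by apply/negP=> /cpar[/fresh].
rewrite (bigD1 v) //= eqxx /=.
rewrite (eq_bigr (fun w => size (children st w))) => [|w /negPf -> //].
have card_u : #|[pred w | ~~ marked st w]|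
            = #|[pred w | ~~ (if w == u then true else marked st w)]|.+1.
  rewrite (cardD1 u) unfold_in /= mNu add1n; congr _.+1.
  by apply: eq_card => w; rewrite !inE; case: eqP.
by move: ccount; rewrite (bigD1 v) //= card_u addnS !addSn.
Qed.

(** Applied to the concatenation of the next level, the current level and the earlier ones: [uniq]
    then also says that the levels are disjoint. *)
Definition discovered (s : seq (node G)) st : Prop :=
  [/\ rooted st, uniq s & {in s, forall w, marked st w}].

Lemma runs_exploreC v st s : v \in s ->
  forall next, discovered (next ++ s) st ->
  runs (exploreC v (st, next)) (fun x => discovered (x.2 ++ s) x.1)
    (#|edge G| * 12).+1.
Proof.
move=> vs next dsc; rewrite cardE.
pose P x := discovered (x.2 ++ s) x.1.
apply: (@runs_forC_const _ _ P) => // e [{}st {}next] _ {}dsc.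
have mv : marked st v.
  by case: dsc => _ _; apply; rewrite mem_cat vs orbT.
(* [otherC] takes 4 instructions and recording a new child 7; the iteration itself makes it 12 per
   edge. *)
rewrite /otherC; apply: (@runs_le _ _ _ (4 + 7)) => //.
pose ok o := if o is Some u then
  [/\ incident v e, incident u e, u != v
    & forall w, incident w e -> (w == u) || (w == v)] else True.
apply: (@runs_bind _ _ _ _ ok).
  do 4 apply: runs_op; apply: runs_ret; rewrite /ok /incident.
  have sd := src_neq_dst e; case: (v =P src e) => [->|_].
    by split; rewrite ?eqxx ?orbT 1?eq_sym // => w; rewrite orbC.
  by case: (v =P dst e) => [->|_] //; split; rewrite ?eqxx ?orbT.
case=> [u [ve ue uv ends]|_]; last exact: runs_ret.
apply: runs_op => /=; case: ifPn => [_|mNu]; first exact: runs_ret.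
do 6 apply: runs_op; apply: runs_ret.
have [rst uniq_s mark_s] := dsc; split=> /=; first exact: rooted_step.
  by rewrite uniq_s andbT; apply: contra mNu => /mark_s.
by move=> w; rewrite inE => /predU1P[->|/mark_s ->]; rewrite ?eqxx ?if_same.
Qed.

Lemma runs_bfsC r :
  runs (bfsC r) (fun x => rooted x.1 /\ uniq x.2)
    (n.+1 * 7 + n * (#|edge G| * 12 + 4) + 3 * n + 5).
Proof.
pose P (x : bfsState G * seq (node G) * seq (node G)) :=
  discovered (x.1.2 ++ x.2) x.1.1.
(* Each node not yet in the order list holds the credit for its expansion: [#|edge G| * 12 + 2] for
   its iteration of the exploring loop and 2 for prepending it. The remaining overhead of a round is
   within [c = 4]. *)
pose pot (x : bfsState G * seq (node G) * seq (node G)) :=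
  (n - size x.2) * (#|edge G| * 12 + 4).
rewrite /bfsC.
apply: (@runs_le _ _ _
  (n.+1 + (n.+1 + (n.+1 + (n.+1 * 5 + n * (#|edge G| * 12 + 4) + 0).+1)).+1));
  last by lia.
apply: (@runs_bind _ _ _ _ (eq (fun=> false))) => // _ <-; apply: runs_op.
apply: (@runs_bind _ _ _ _ (eq (fun=> None))) => // _ <-.
apply: (@runs_bind _ _ _ _ (eq (fun=> [::]))) => // _ <-; apply: runs_op.
apply: (@runs_bind _ _ _ _ P); last first.
  move=> [[st lev] ord] [rst uniq_s _]; apply: runs_ret; split=> //=.
  by move: uniq_s; rewrite cat_uniq => /and3P[].
apply: runs_le (runs_loopC (P := P) (pot := pot) (c := 4) _ _ _) _;
  last by rewrite /pot /= subn0.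
  split=> //=; first exact: rooted_init.
move=> [[st lev] ord] dsc; have [rst uniq_s mark_s] := dsc.
rewrite /pot; case: (boolP (nilp lev)) => lev0.
  exists 1; apply: runs_op; rewrite [nilp _]lev0; apply: runs_ret.
  by split=> //=; lia.
have size_s : size lev + size ord <= n.
  by rewrite -size_cat -(card_uniqP uniq_s); apply: max_card.
exists ((2 * size lev).+1 + (size lev * (#|edge G| * 12).+2).+1).+1.
apply: runs_op; rewrite [nilp _](negPf lev0) -[X in runs _ _ X]addn0 -addnA.
apply: (@runs_bind _ _ _ _ (eq (catrev lev ord))).
  by rewrite -result_prependC; split=> //; apply: time_prependC.
move=> _ <-.
pose Q (x : bfsState G * seq (node G)) := discovered (x.2 ++ lev ++ ord) x.1.
apply: (@runs_bind _ _ _ _ Q).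
  apply: (@runs_forC_const _ _ Q) => // v [st' next] v_lv d'.
  by apply: runs_exploreC => //; rewrite mem_cat v_lv.
move=> [st' next] [rst' uniq_s' mark_s']; apply: runs_ret.
(* [prependC] reverses the level, so the two lists agree only up to permutation. *)
have perm_s : perm_eq (next ++ lev ++ ord) (next ++ catrev lev ord).
  by rewrite perm_cat2l catrevE perm_cat2r perm_sym perm_rev.
split.
  split=> //=; first by rewrite -(perm_uniq perm_s).
  by move=> w; rewrite -(perm_mem perm_s); apply: mark_s'.
rewrite /= catrevE size_cat size_rev; set D := #|edge G| * 12.
(* By [size_s] no subtraction truncates, so the potential drops by exactly the credit of the current
   level. *)
have -> : n - size ord = (n - (size lev + size ord)) + size lev by lia.
rewrite mulnDl; move: (n - _) => m; lia.
Qed.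

End Rooting.

(** * Processing a node *)

Section Processing.
Variables (G : temporalGraph) (r : node G) (st : bfsState G).
Hypotheses (single : single_interval G) (rooted_st : rooted st).
Implicit Types (e : edge G) (u v w : node G) (M : node G -> seq (edge G)).

Local Notation n := #|node G|.

(** The common ambient set of all the lists [M u]. It has at most one entry per node, so that a
    union of two such lists takes time quadratic in [n]. *)
Definition tree_edges : seq (edge G) := pmap (parent st) (enum (node G)).

Lemma size_tree_edges : size tree_edges <= n.
Proof. by rewrite size_pmap cardE count_size. Qed.

Lemma parent_tree_edge u e : parent st u = Some e -> e \in tree_edges.
Proof. by rewrite mem_pmap => <-; rewrite map_f ?mem_enum. Qed.

Definition kid_edges v : seq (edge G) := [seq ue.2 | ue <- children st v].

(** Two children with the same edge have the same parent edge, so [parent_inj] identifies them. *)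
Lemma kid_edges_uniq v : uniq (kid_edges v).
Proof.
rewrite map_inj_in_uniq ?(children_uniq rooted_st) //.
move=> [u e] [u' e'] /(child_parent rooted_st)[pu _ _].
move=> /(child_parent rooted_st)[pu' _ _] /= ee'; rewrite -{}ee' in pu' *.
by rewrite (parent_inj rooted_st pu pu').
Qed.

(** The last conjunct holds because a child whose edge were also the parent edge of [v] would be [v]
    itself, by [parent_inj]. *)
Lemma kid_edgesP v e : e \in kid_edges v ->
  [/\ e \in tree_edges, incident v e & parent st v <> Some e].
Proof.
case/mapP=> -[u e'] /(child_parent rooted_st)[pu ve uv] /= ->.
split=> //; first exact: parent_tree_edge pu.
by move=> pv; rewrite (parent_inj rooted_st pu pv) eqxx in uv.
Qed.

Lemma star_kid_edges v (S : seq (edge G)) :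
  uniq_sub (kid_edges v) S -> star S.
Proof.
by case=> uniq_S sub_S; split=> //; exists v => e /sub_S/kid_edgesP[].
Qed.

(** Makes the call to [MaxNOS] on the candidates extended by the parent edge legitimate: that edge
    is not a child edge, so no duplicate arises. *)
Lemma star_parent_kid_edges v e (S : seq (edge G)) :
  parent st v = Some e -> uniq_sub (kid_edges v) S -> star (e :: S).
Proof.
move=> pv [uniq_S sub_S]; split.
  by rewrite /= uniq_S andbT; apply/negP=> /sub_S/kid_edgesP[].
exists v => e'; rewrite inE => /predU1P[->|/sub_S/kid_edgesP[] //].
exact: (parent_incident rooted_st).
Qed.

(** With one interval per edge, the double loop over the interval lists compares a single pair. *)
Lemma time_overlapC e e' : time (overlapC e e') <= 20.
Proof.
rewrite /overlapC; move: (single e) (single e').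
by case: (intervals e) => [|i []] // _; case: (intervals e') => [|j []].
Qed.

(** Imposed on every cell, also on those still empty, so that it holds of the initial array and no
    processing order has to be tracked. *)
Definition tree_sets M : Prop := forall u, uniq_sub tree_edges (M u).

Lemma runs_TM1C M kids : tree_sets M ->
  runs (TM1C M kids) (uniq_sub tree_edges)
    (size kids * (n * (2 * n + 3)).+3).+1.
Proof.
move=> tM; apply: (@runs_forC_const _ _ (uniq_sub tree_edges)) => // ue s _ us.
apply: runs_op; have [_ sub_M] := tM ue.1.
apply: runs_le (runs_unionC sub_M us) _.
have le_n := size_tree_edges.
rewrite ltnS leq_mul ?leq_add2r ?leq_mul2l //.
exact: leq_trans (size_uniq_sub (tM _)) le_n.
Qed.

Lemma runs_R0C M v : tree_sets M ->
  runs (R0C M (children st v)) (uniq_sub (kid_edges v))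
    (size (children st v) * (n * 21 + 4)).+1.
Proof.
move=> tM; split; last first.
  have [//] : runs (R0C M (children st v)) (fun=> True)
                (size (children st v) * (n * 21 + 4)).+1.
  rewrite addnS; apply: (@runs_forC_const _ _ (fun=> True)) => // ue s _ _.
  apply: (@runs_le _ _ _ ((size (M ue.1) * 21).+1 + 1).+1).
    apply: runs_op; apply: runs_bind (runs_has_C _) _ => [e _|b _].
      exact: time_overlapC.
    by case: b.
  rewrite addn1 -addn3 leq_add2r leq_mul2r /=.
  exact: leq_trans (size_uniq_sub (tM ue.1)) size_tree_edges.
(* The outcome of the overlap test may stay opaque: whatever it is, the loop returns a reversed
   sublist of the child edges. *)
pose bad ue := result (has_C (fun e => overlapC e ue.2) (M ue.1)).
rewrite (result_forC_filter (b := bad) (g := snd)) => [|ue s]; last first.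
  by rewrite /bind /= -/(bad ue); case: (bad ue).
rewrite catrevE cats0.
have sub : subseq [seq ue.2 | ue <- children st v & ~~ bad ue] (kid_edges v).
  exact: map_subseq (filter_subseq _ _).
split; first by rewrite rev_uniq (subseq_uniq sub) ?kid_edges_uniq.
by move=> e; rewrite mem_rev; apply: mem_subseq.
Qed.

(** * Calls to [MaxNOS] and the cost of a node *)

Section MaxNOS.
Variables (MaxNOS : seq (edge G) -> cost (seq (edge G))) (K : nat).
Hypothesis MaxNOS_correct :
  forall S, star S -> is_MaxNOS S (result (MaxNOS S)).
Hypothesis MaxNOS_time :
  forall S, star S -> time (MaxNOS S) <= K * (size S * up_log 2 (size S)).+1.

(** From [s < 2 ^ s] one gets [up_log 2 s <= s], which replaces the logarithm by a second factor
    [s]. *)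
Lemma runs_MaxNOS S : star S ->
  runs (MaxNOS S) (uniq_sub S) (K * (size S ^ 2).+1).
Proof.
move=> star_S; split; first by case: (MaxNOS_correct star_S).
apply: leq_trans (MaxNOS_time star_S) _.
rewrite leq_mul2l ltnS -mulnn leq_mul2l.
by rewrite (up_log_min (p := 2)) ?orbT // ltnW // ltn_expl.
Qed.

(** The extended candidate set has at most [k + 1] edges, and deleting the parent edge does not
    lengthen the list. Inclusion in [tree_edges] and this length are what the union with [TM1] asks
    of [F]. *)
Lemma runs_FC v (R0 : seq (edge G)) : uniq_sub (kid_edges v) R0 ->
  runs (FC MaxNOS r st v R0)
    (fun F => {subset F <= tree_edges} /\ size F <= (size (children st v)).+1)
    (2 * (K * ((size (children st v)).+1 ^ 2).+1)
       + 7 * (size (children st v)).+1).+4.+4.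
Proof.
set k := size (children st v) => uR0.
have size_R0 : size R0 <= k.
  by rewrite (leq_trans (size_uniq_sub uR0)) // size_map.
have R0_tree : {subset R0 <= tree_edges}.
  by case: uR0 => _ sub e /sub/kid_edgesP[].
have timeK S : size S <= k.+1 ->
    K * (size S ^ 2).+1 <= K * (k.+1 ^ 2).+1.
  by move=> le_S; rewrite leq_mul2l ltnS leq_exp2r // le_S orbT.
have runs_R0 : runs (MaxNOS R0) (uniq_sub R0) (K * (k.+1 ^ 2).+1).
  apply: runs_le (runs_MaxNOS (star_kid_edges uR0)) _.
  exact: timeK (leqW size_R0).
rewrite /FC; apply: runs_op; case: ifP => [_|_]; first exact: runs_ret.
apply: runs_op; case: ifP => [_|_].
  apply: (@runs_le _ _ _ (K * (k.+1 ^ 2).+1)); last by lia.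
  have [uX tX] := runs_R0; split=> //; split.
    by case: uX => _ sub e /sub; apply: R0_tree.
  exact: leq_trans (size_uniq_sub uX) (leqW _).
apply: runs_op; case pv: (parent st v) => [e|]; last exact: runs_ret.
apply: runs_op.
have star_P := star_parent_kid_edges pv uR0.
apply: (@runs_le _ _ _ (K * (k.+1 ^ 2).+1 + (K * (k.+1 ^ 2).+1
  + ((2 * k.+1).+1 + ((2 * k.+1).+1 + (3 * k.+1).+1.+1))))); last by lia.
have runs_P : runs (MaxNOS (e :: R0)) (uniq_sub (e :: R0)) (K * (k.+1 ^ 2).+1).
  by apply: runs_le (runs_MaxNOS star_P) _; apply: timeK.
apply: runs_bind runs_P _ => XP uXP.
apply: runs_bind runs_R0 _ => X uX.
have size_XP : size XP <= k.+1 by apply: leq_trans (size_uniq_sub uXP) _.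
have size_X : size X <= k by apply: leq_trans (size_uniq_sub uX) _.
have XP_tree : {subset XP <= tree_edges}.
  move=> e'; case: uXP => _ /[apply]; rewrite inE => /predU1P[->|/R0_tree//].
  exact: parent_tree_edge pv.
apply: runs_bind (runs_le (runs_lengthC XP) _) _ => [|kP _].
  by rewrite ltnS leq_mul2l.
apply: runs_bind (runs_le (runs_lengthC X) _) _ => [|kX _].
  by rewrite ltnS leq_mul2l leqW.
apply: runs_op; case: ifP => _.
  have [[sub_Y size_Y] t_Y] := runs_removeC e XP; split.
    by split=> [e' /sub_Y/XP_tree//|]; apply: leq_trans size_XP.
  by apply: leq_trans t_Y _; rewrite ltnS leq_mul2l.
apply: runs_ret; split; last exact: leqW.
by case: uX => _ sub e' /sub; apply: R0_tree.
Qed.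

Lemma runs_nodeC v M : tree_sets M ->
  runs (nodeC MaxNOS r st v M) tree_sets
    ((100 + 10 * K) * n ^ 2 * (size (children st v)).+1).
Proof.
set k := size (children st v) => tM.
have n_gt0 : 0 < n by apply/card_gt0P; exists r.
have k_le : k <= n.
  apply: leq_trans (children_count rooted_st).
  by rewrite (bigD1 v) //= -addnA leq_addr.
have le_n := size_tree_edges.
have tM_set X : uniq_sub tree_edges X ->
    tree_sets (fun j => if j == v then X else M j).
  by move=> uX u; case: ifP.
set t1 := (k * (n * (2 * n + 3)).+3).+1.
set t2 := (k * (n * 21 + 4)).+1.
set t3 := (2 * (K * (k.+1 ^ 2).+1) + 7 * k.+1).+4.+4.
set t4 := (k.+1 * (2 * n + 3)).+1.
apply: (@runs_le _ _ _ (t1 + (t2 + (t3 + (t4 + ((2 * n).+1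
  + ((2 * n).+1 + 2))).+1))).+2); last first.
  (* Every term is compared with [q]. For the quadratic one, [k + 1 <= 2 * n <= 2 * n ^ 2] gives
     [(k + 1) ^ 2 <= 2 * q]; the two calls to [MaxNOS] then cost at most [6 * K * q], within the
     allotted [10 * K * q]. *)
  rewrite -mulnA; set q := n ^ 2 * k.+1.
  have knn : k * (n * n) <= q by rewrite /q -mulnn mulnC leq_mul2l leqnSn orbT.
  have nq : n <= q.
    by rewrite /q -mulnn -mulnA leq_pmulr // muln_gt0 n_gt0.
  have kn : k * n <= q by apply: leq_trans knn; rewrite leq_mul2l leq_pmulr ?orbT.
  have k2 : k.+1 ^ 2 <= 2 * q.
    rewrite /q -mulnn mulnA leq_mul2r /=; apply: leq_trans (_ : 2 * n <= _).
      by lia.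
    by rewrite leq_mul2l -mulnn leq_pmulr.
  have Kq : K * (k.+1 ^ 2).+1 <= K * (3 * q) by rewrite leq_mul2l; lia.
  have -> : (100 + 10 * K) * q = 100 * q + 10 * (K * q) by lia.
  rewrite /t1 /t2 /t3 /t4; lia.
apply: runs_op; apply: runs_op; case: ifP => _.
  by split=> //; apply: tM_set.
apply: runs_bind (runs_TM1C _ tM) _ => TM1 u1.
apply: runs_bind (runs_R0C _ tM) _ => R0 uR0.
apply: runs_bind (runs_FC uR0) _ => F [F_tree size_F]; apply: runs_op.
apply: (@runs_bind _ _ _ _ (uniq_sub tree_edges)) => [|TM2 u2].
  case: ifP => _; first by apply: runs_ret.
  apply: runs_le (runs_unionC F_tree u1) _.
  by rewrite ltnS leq_mul // leq_add2r leq_mul2l.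
have size_n X : uniq_sub tree_edges X -> size X <= n.
  by move=> uX; apply: leq_trans (size_uniq_sub uX) le_n.
apply: runs_bind (runs_le (runs_lengthC TM1) _) _ => [|k1 _].
  by rewrite ltnS leq_mul2l size_n.
apply: runs_bind (runs_le (runs_lengthC TM2) _) _ => [|k2 _].
  by rewrite ltnS leq_mul2l size_n.
apply: runs_op; apply: runs_op1; apply: tM_set; by case: ifP.
Qed.

(** Since [s] has no duplicates, [children_count] bounds the child lists of its nodes by [n] in
    total, so the weights [k + 1] sum to at most [n + n]: this doubles the constants of
    [runs_nodeC]. The extra [n] is the loop overhead. *)
Lemma runs_nodes (s : seq (node G)) : uniq s ->
  runs (forC s (fun=> [::]) (nodeC MaxNOS r st)) tree_sets
    ((200 + 20 * K) * n ^ 3 + n).+1.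
Proof.
move=> uniq_s; apply: runs_le (runs_forC (P := tree_sets) _ _) _.
- by [].
- by move=> v M _; apply: runs_nodeC.
rewrite ltnS; under eq_bigr do rewrite -addn1.
rewrite big_split /= sum1_size leq_add //; last first.
  by rewrite -(card_uniqP uniq_s) max_card.
rewrite -big_distrr /=.
under eq_bigr do rewrite -addn1.
rewrite big_split /= sum1_size.
have le_s : size s <= n by rewrite -(card_uniqP uniq_s) max_card.
have le_k : \sum_(v <- s) size (children st v) <= n.
  apply: leq_trans (children_count rooted_st).
  rewrite big_uniq //= big_mkcond /=; apply: leq_trans (leq_addr _ _).
  by apply: leq_sum => v _; case: ifP.
have -> : (200 + 20 * K) * n ^ 3 = (100 + 10 * K) * n ^ 2 * (n + n).
  by rewrite (expnSr n 2); lia.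
by rewrite leq_mul2l leq_add ?orbT.
Qed.

End MaxNOS.
End Processing.

(** * Total running time *)

Theorem theorem3
    (MaxNOS : forall G : temporalGraph, seq (edge G) -> cost (seq (edge G)))
    (MaxNOS_correct : forall (G : temporalGraph) (S : seq (edge G)),
      single_interval G -> star S -> is_MaxNOS S (result (MaxNOS G S)))
    (MaxNOS_time : exists K : nat, forall (G : temporalGraph) (S : seq (edge G)),
      single_interval G -> star S ->
      time (MaxNOS G S) <= K * (size S * up_log 2 (size S)).+1) :
  exists C : nat, forall (G : temporalGraph) (r : node G),
    is_tree G -> single_interval G ->
    time (algorithmA (MaxNOS G) r) <= C * #|node G| ^ 3.
Proof.
have [K timeK] := MaxNOS_time.
(* [200 + 20 * K] comes from processing the nodes; the other 100 absorbs the rooting and the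
   lower-order terms. *)
exists (300 + 20 * K) => G r _ single.
set n := #|node G|.
have n_gt0 : 0 < n by apply/card_gt0P; exists r.
set b := n.+1 * 7 + n * (#|edge G| * 12 + 4) + 3 * n + 5.
have [] // : runs (algorithmA (MaxNOS G) r) (fun=> True)
  (b + (n.+1 + (((200 + 20 * K) * n ^ 3 + n).+1 + 1)).+2).
  apply: runs_bind (runs_bfsC r) _ => -[st s] [/= rooted_st uniq_s].
  apply: runs_op; apply: runs_op; case: ifP => _; first exact: runs_ret.
  apply: (@runs_bind _ _ _ _ (eq (fun=> [::]))) => // _ <-.
  apply: runs_bind (runs_nodes r single rooted_st _ _ uniq_s) _ => [S|S|M _].
  - exact: MaxNOS_correct.
  - exact: timeK.
  - exact: runs_op1.
move=> _ /leq_trans; apply; rewrite /b.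
have := card_edge_le G; rewrite -/n; move: #|edge G| => E le_E.
have n3 : n ^ 3 = n * n ^ 2 by rewrite expnS.
have le_nE : n * E <= n ^ 3 by rewrite n3 leq_mul2l le_E orbT.
have le_n3 : n <= n ^ 3 by rewrite -{1}[n]expn1 leq_pexp2l.
lia.
Qed.
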